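(* Let $\sigma$ be a partition of a positive integer $r$ with largest part $\Delta$ and smallest part $\delta$, let $n,q$ be positive integers, let $H=H(n,r,q\mid\sigma)$, and write $s=s(\sigma)$. Let $\alpha,\beta$ be integers with $2\le\alpha$, $\Delta \geq \alpha$, $\delta \leq r-\beta$ and $\alpha \leq s \leq \beta$. Suppose \[ q=(\beta-\alpha+1) \left\lfloor \frac{\Delta-1}{\alpha-1} \right\rfloor + \Delta -1 \quad\text{and}\quad n \geq \binom{\beta +1}{\alpha -1}(s-1) + s. \] Then: (1) $H$ has no $k$-$(\alpha,\beta)$-colouring for any $k \leq \beta- 1$; (2) $H$ has a $\beta$-$(\alpha,\beta)$-colouring; (3) $H$ has no $(\beta+1)$-$(\alpha,\beta)$-colouring; (4) $H$ has a $k$-$(\alpha,\beta)$-colouring for every integer $k$ with \[ \left\lceil \frac{ n-\left(s-1- (\alpha -1) \left\lfloor \frac{s-1}{\alpha -1} \right\rfloor\right) }{\left\lfloor \frac{s - 1}{\alpha - 1} \right\rfloor} \right\rceil \le k \le n. \] Consequently the $(\alpha,\beta)$-spectrum of $H$ has a gap.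
   Context: For a partition $\sigma$ of $r$ and positive integers $n,q$, the $\sigma$-hypergraph $H(n,r,q\mid\sigma)$ is the $r$-uniform hypergraph whose vertex set has $nq$ vertices partitioned into $n$ classes $V_1,\dots,V_n$ of $q$ vertices each, and in which an $r$-subset $K$ of the vertex set is an edge if and only if the multiset of non-zero cardinalities $|K\cap V_i|$, $1\le i\le n$, is exactly the partition $\sigma$. $s(\sigma)$ denotes the number of parts of $\sigma$, $\Delta$ its largest part and $\delta$ its smallest part. For integers $\alpha\le\beta$, an $(\alpha,\beta)$-colouring is an assignment of colours to the vertices such that every edge contains at least $\alpha$ and at most $\beta$ distinct colours; a $k$-$(\alpha,\beta)$-colouring is one using exactly $k$ colours. The $(\alpha,\beta)$-spectrum is the set of $k$ for which a $k$-$(\alpha,\beta)$-colouring exists; it has a gap if there are integers $k_1<k_2<k_3$ with $k_1,k_3$ in the spectrum and $k_2$ not. *)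

(* Defs.v *)
From mathcomp Require Import all_boot all_order all_algebra.

Set Implicit Arguments.
Unset Strict Implicit.
Unset Printing Implicit Defensive.

Definition is_partition (sigma : seq nat) (r : nat) : bool :=
  [&& sorted geq sigma, 0 \notin sigma & sumn sigma == r].

Definition largest_part (sigma : seq nat) : nat := \max_(p <- sigma) p.

(* The neutral element of the iterated minimum is an upper bound of all the
   parts, so for a non-empty [sigma] this is the true minimum. *)
Definition smallest_part (sigma : seq nat) : nat :=
  \big[minn/largest_part sigma]_(p <- sigma) p.

Definition vclass (n q : nat) (i : 'I_n) : {set 'I_n * 'I_q} :=
  [set v | v.1 == i].

(* The edge set of H(n,r,q|sigma), on the vertex set 'I_n * 'I_q; [perm_eq]
   is equality of multisets. *)
Definition sigma_hypergraph (n r q : nat) (sigma : seq nat) :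
    {set {set 'I_n * 'I_q}} :=
  [set K : {set 'I_n * 'I_q} | (#|K| == r) &&
     perm_eq [seq m <- [seq #|K :&: vclass q i| | i <- enum 'I_n] | m != 0]
             sigma].

Section Colourings.

Variables (T : finType) (E : {set {set T}}).

Definition num_colours (c : T -> nat) (A : {set T}) : nat :=
  size (undup [seq c x | x in A]).

Definition colouring (alpha beta : nat) (c : T -> nat) : Prop :=
  forall K : {set T}, K \in E -> alpha <= num_colours c K <= beta.

(* Exactly [k] colours are used on the whole vertex set. Since that set is
   finite, taking the colours in [nat] is no restriction. *)
Definition has_k_colouring (alpha beta k : nat) : Prop :=
  exists c : T -> nat, colouring alpha beta c /\ num_colours c [set: T] = k.

Definition spectrum (alpha beta : nat) : nat -> Prop :=
  fun k => has_k_colouring alpha beta k.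

End Colourings.

Definition has_gap (S : nat -> Prop) : Prop :=
  exists k1 k2 k3 : nat, [/\ k1 < k2, k2 < k3, S k1, ~ S k2 & S k3].

(* Main.v *)
Require Import Defs.
From mathcomp Require Import all_boot all_order all_algebra.
From mathcomp Require Import zify lra.

(* Say that a class is concentrated if some [alpha - 1] colours cover at least
   [Delta] of its vertices. If every edge sees at least [alpha] colours and at
   most [beta + 1] colours are used, then each set of [alpha - 1] colours serves
   fewer than [s] classes, so at least [s] classes are not concentrated; the
   value of [q] forces each of these to contain at least [beta] colours. This
   excludes fewer than [beta] colours, and with [beta + 1] colours an edge
   spread over such classes can be made to see all of them. Conversely,
   colouring the [j]-th vertex of each class by [j] mod [beta], or the whole
   [i]-th class by [i] mod [k], gives the required colourings. *)

Set Implicit Arguments.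
Unset Strict Implicit.
Unset Printing Implicit Defensive.

Import Order.TTheory GRing.Theory Num.Theory.

(** * Sets of prescribed size, and counts of residues and colours *)

Lemma subset_of_card (T : finType) (A B : {set T}) (m : nat) :
  A \subset B -> #|A| <= m <= #|B| ->
  exists K : {set T}, [/\ A \subset K, K \subset B & #|K| = m].
Proof.
move=> AB; elim: m => [|m IHm] /andP[lem leB].
  by exists A; split => //; apply/eqP; rewrite -leqn0.
have [Am|Am] := eqVneq #|A| m.+1; first by exists A.
have [|K [AK KB Km]] := IHm; first by lia.
have [x xB xK] : exists2 x, x \in B & x \notin K.
  apply/subsetPn; apply: contraTN leB => /subset_leq_card; lia.
exists (x |: K); split.
- exact: subset_trans AK (subsetU1 _ _).
- by rewrite subUset sub1set xB.
- by rewrite cardsU1 xK Km.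
Qed.

(** An index below [k * f] is determined by its residue mod [k] and a quotient below [f], so each
    residue occurs at most [f] times there; at most [t] indices lie beyond. Both explicit colourings
    get their lower bound from this. *)
Lemma card_le_num_residues (N k f t : nat) (A : {set 'I_N}) :
  N <= k * f + t ->
  #|A| <= num_colours (fun i : 'I_N => i %% k) A * f + t.
Proof.
move=> leN; rewrite /num_colours.
rewrite -(cardsID [set i : 'I_N | i < k * f] A) leq_add //.
  set U := undup [seq i %% k | i : 'I_N in A].
  have -> : size U * f = size [seq (u, j) | u <- U, j <- iota 0 f].
    by rewrite size_allpairs size_iota.
  rewrite cardE.
  pose g (i : 'I_N) := (i %% k, i %/ k).
  rewrite -(size_map g) uniq_leq_size //.
    rewrite map_inj_uniq ?enum_uniq // => i j [eqm eqd].
    by apply/val_inj; rewrite /= (divn_eq i k) eqm eqd -divn_eq.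
  move=> _ /mapP[i + ->]; rewrite mem_enum !inE => /andP[iA ltif].
  apply/allpairsP; exists (g i); split=> //=.
    by rewrite mem_undup; apply/imageP; exists i.
  by rewrite mem_iota /= ltn_divLR 1?mulnC //; case: (k) ltif; rewrite ?mul0n.
rewrite -[leqRHS](size_iota (k * f)) cardE -(size_map val) uniq_leq_size //.
  by rewrite map_inj_uniq ?enum_uniq //; apply: val_inj.
move=> _ /mapP[i + ->]; rewrite mem_enum !inE mem_iota => /andP[geif _].
have := ltn_ord i; move: geif leN; rewrite -leqNgt /=; lia.
Qed.

(** Removing duplicates only tests equality of colours, which [c] and [d] decide alike. *)
Lemma num_colours_imset (T F : finType) (c : T -> nat) (d : T -> F)
    (A : {set T}) :
  (forall x y, (c x == c y) = (d x == d y)) -> num_colours c A = #|d @: A|.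
Proof.
move=> cd; rewrite /num_colours.
have -> : #|d @: A| = size (undup [seq d x | x in A]).
  rewrite -(card_uniqP (undup_uniq [seq d x | x in A])); apply: eq_card => y.
  by rewrite mem_undup; apply/imsetP/imageP.
rewrite /image_mem; elim: (enum A) => //= x e IHe.
suff -> : (c x \in map c e) = (d x \in map d e).
  by case: ifP => //= _; rewrite IHe.
by elim: e {IHe} => //= y e IHe; rewrite !inE IHe cd.
Qed.

(** * Colours seen by a set of vertices *)

Section Colours.

Variables (T F : finType) (d : T -> F).

Lemma card_setI_preimset (W : {set T}) (S : {set F}) :
  #|W :&: d @^-1: S| = \sum_(x in S) #|W :&: d @^-1: [set x]|.
Proof.
rewrite -sum1_card (partition_big d (mem S)) /=; last first.
  by move=> v; rewrite !inE => /andP[].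
apply: eq_bigr => x xS; rewrite -sum1_card; apply: eq_bigl => v.
by rewrite !inE; case: eqP => [->|]; rewrite ?xS ?andbF ?andbT.
Qed.

Lemma setI_preimset_imset (W : {set T}) : W :&: d @^-1: (d @: W) = W.
Proof.
by apply/setIidPl/subsetP=> v vW; rewrite inE imset_f.
Qed.

(* The colours used more than [g] times on [W] are fewer than [a], so some [S]
   contains them all, and every colour outside [S] is used at most [g] times. *)
Lemma num_colours_of_small_unions (W : {set T}) (a b g m : nat) :
  0 < b -> 0 < g -> 0 < m -> a <= #|F| -> m <= a * g.+1 ->
  b * g + m.-1 <= #|W| ->
  (forall S : {set F}, #|S| = a -> #|W :&: d @^-1: S| < m) ->
  b + a <= #|d @: W|.
Proof.
move=> b_gt0 g_gt0 m_gt0 aF mag leW small.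
pose D := d @: W; pose mu x := #|W :&: d @^-1: [set x]|.
pose D' := [set x | g < mu x].
have D'_D : D' \subset D.
  apply/subsetP=> x; rewrite inE => /(leq_ltn_trans (leq0n g)).
  rewrite card_gt0 => /set0Pn[v]; rewrite !inE => /andP[vW /eqP <-].
  exact: imset_f.
(* Otherwise [a] of these colours would cover at least [a * g.+1 >= m] vertices of [W]. *)
have D'_lt : #|D'| < a.
  rewrite ltnNge; apply/negP=> aD'.
  have [|S [_ SD' Sa]] := @subset_of_card _ set0 D' a (sub0set _).
    by rewrite cards0.
  have := small S Sa; rewrite card_setI_preimset ltnNge => /negP; apply.
  apply: leq_trans mag _; rewrite -Sa -sum_nat_const; apply: leq_sum => x xS.
  by move/subsetP/(_ x xS): SD'; rewrite inE.
(* Otherwise some [S] of size [a] contains every colour of [W] and so covers all of [W], which has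
   at least [m] vertices. *)
have D_ge : a <= #|D|.
  rewrite leqNgt; apply/negP=> Da.
  have [|S [DS _ Sa]] := @subset_of_card _ D setT a (subsetT _).
    by rewrite cardsT aF ltnW.
  have := small S Sa.
  have /setIidPl -> : W \subset d @^-1: S.
    by apply/subsetP=> v vW; rewrite inE (subsetP DS) // imset_f.
  by have : 0 < b * g; [rewrite muln_gt0 b_gt0 | lia].
have [|S [D'S SD Sa]] := @subset_of_card _ D' D a D'_D.
  by rewrite D_ge ltnW.
(* The colours of [S] cover at most [m.-1] vertices, so at least [b * g] remain for the colours
   outside [S], each used at most [g] times. *)
have leDS : b * g <= #|D :\: S| * g.
  rewrite -(leq_add2r m.-1); apply: (leq_trans leW).
  have -> : #|W| = #|W :&: d @^-1: D| by rewrite setI_preimset_imset.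
  rewrite card_setI_preimset (big_setID S) /= (setIidPr SD) addnC leq_add //.
    rewrite -sum_nat_const leq_sum // => x; rewrite in_setD => /andP[xS _].
    by rewrite leqNgt; apply: contra xS => gx; rewrite (subsetP D'S) ?inE.
  by rewrite -card_setI_preimset; have := small S Sa; lia.
rewrite -(cardsID S (d @: W)) (setIidPr SD) Sa addnC leq_add2l.
by rewrite leq_pmul2r in leDS.
Qed.

(** As long as fewer than [b] colours of [C] are seen, [W] offers an unseen one, and a single vertex
    brings it in. *)
Lemma add_new_colours (A W : {set T}) (C : {set F}) (b p : nat) :
  b <= #|d @: W :&: C| ->
  exists X : {set T}, [/\ X \subset W, #|X| <= p &
    minn b (#|d @: A :&: C| + p) <= #|d @: (A :|: X) :&: C|].
Proof.
move=> leb; elim: p => [|p [X [XW Xp leX]]].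
  by exists set0; rewrite sub0set cards0 setU0 addn0 geq_minr.
have [bX|Xb] := leqP b #|d @: (A :|: X) :&: C|.
  by exists X; split=> //; [exact: leqW | rewrite (leq_trans (geq_minl _ _))].
have [y yW yX] : exists2 y, y \in d @: W :&: C & y \notin d @: (A :|: X) :&: C.
  apply/subsetPn; apply: contraTN Xb => /subset_leq_card; lia.
have [/imsetP[w wW yw] yC] := setIP yW.
exists (w |: X); split.
- by rewrite subUset sub1set wW.
- by rewrite cardsU1; case: (w \notin X); lia.
- have : y |: (d @: (A :|: X) :&: C) \subset d @: (A :|: (w |: X)) :&: C.
    rewrite subUset sub1set inE yC andbT yw imset_f ?inE ?eqxx ?orbT //=.
    by rewrite setSI // imsetS // setUS // subsetU1.
  by move/subset_leq_card; rewrite cardsU1 yX; lia.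
Qed.

End Colours.

(** * Construction of edges with prescribed intersections with the classes *)

Lemma map_nth_index (T : eqType) (I : seq T) (tau : seq nat) :
  uniq I -> size I = size tau -> [seq nth 0 tau (index i I) | i <- I] = tau.
Proof.
move=> uI sI; apply: (@eq_from_nth _ 0); rewrite size_map // => j ltj.
case: I uI sI ltj => // i0 I uI sI ltj.
by rewrite (nth_map i0) // index_uniq.
Qed.

Section Edges.

Variables (n q r : nat) (sigma : seq nat).
Hypotheses (sigma_neq0 : 0 \notin sigma) (sum_sigma : sumn sigma = r).

Local Notation H := (sigma_hypergraph n r q sigma).
Local Notation V := (@vclass n q).

Lemma card_vclass i : #|V i| = q.
Proof.
have -> : V i = setX [set i] [set: 'I_q].
  by apply/setP=> v; rewrite !inE andbT.
by rewrite cardsX cards1 cardsT card_ord mul1n.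
Qed.

Lemma setI_other_vclass (X : {set 'I_n * 'I_q}) i j :
  X \subset V i -> j != i -> X :&: V j = set0.
Proof.
move=> XV ji; apply/setP=> v; rewrite !inE; apply: contraNF ji => /andP[vX].
by move=> /eqP <-; move/subsetP/(_ v vX): XV; rewrite inE.
Qed.

Lemma card_sum_vclass (K : {set 'I_n * 'I_q}) :
  #|K| = \sum_(i < n) #|K :&: V i|.
Proof.
rewrite -sum1_card (partition_big fst predT) //=.
apply: eq_bigr => i _; rewrite -sum1_card; apply: eq_bigl => v.
by rewrite !inE.
Qed.

Definition intersection_profile (p : 'I_n -> nat) : bool :=
  perm_eq [seq m <- [seq p i | i <- enum 'I_n] | m != 0] sigma.

Lemma profile_edge (p : 'I_n -> nat) (K : {set 'I_n * 'I_q}) :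
  intersection_profile p -> (forall i, #|K :&: V i| = p i) -> K \in H.
Proof.
rewrite /intersection_profile => pP Kp.
rewrite inE (eq_map Kp) pP andbT card_sum_vclass -sum_sigma.
rewrite -(perm_sumn pP) sumnE big_filter big_map big_enum_cond /=.
apply/eqP; rewrite [RHS]big_mkcond; apply: eq_bigr => i _.
by rewrite Kp; case: eqP.
Qed.

(** The classes are disjoint, so the trace of [K] on each of them can be chosen independently; only
    the sizes matter for being an edge. *)
Lemma edge_between (p : 'I_n -> nat) (A B : {set 'I_n * 'I_q}) :
  intersection_profile p -> A \subset B ->
  (forall i, #|A :&: V i| <= p i <= #|B :&: V i|) ->
  exists2 K, K \in H & (A \subset K) && (K \subset B).
Proof.
move=> pP AB leAB.
have /fin_all_exists[Ki KiP] i : exists K : {set 'I_n * 'I_q},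
    [/\ A :&: V i \subset K, K \subset B :&: V i & #|K| = p i].
  by apply: subset_of_card; rewrite ?setSI.
pose K := \bigcup_i Ki i.
have KV i : K :&: V i = Ki i.
  apply/setP=> v; rewrite in_setI; apply/andP/idP => [[/bigcupP[j _ vj]]|vi].
    have [_ /subsetP/(_ _ vj)] := KiP j.
    by rewrite !inE => /andP[_ /eqP->] _ /eqP <-.
  split; first by apply/bigcupP; exists i.
  by have [_ /subsetP/(_ _ vi)] := KiP i; rewrite inE => /andP[].
exists K.
  by apply: (profile_edge pP) => i; rewrite KV; have [] := KiP i.
apply/andP; split.
  apply/subsetP=> v vA; apply/bigcupP; exists v.1 => //.
  have [/subsetP/(_ v) + _ _] := KiP v.1; apply.
  by rewrite !inE vA eqxx.
apply/bigcupsP => i _; have [_ + _] := KiP i.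
by rewrite subsetI => /andP[].
Qed.

(** A class outside [I] has an index past the end of [tau], so the default 0 marks it as missed.
    Allowing any reordering [tau] of [sigma] lets a chosen part go to the first class. *)
Lemma intersection_profile_nth (I : seq 'I_n) (tau : seq nat) :
  uniq I -> size I = size sigma -> perm_eq tau sigma ->
  intersection_profile (fun i => nth 0 tau (index i I)).
Proof.
move=> uI sI perm_tau; rewrite /intersection_profile.
apply: (perm_trans _ perm_tau); have st := perm_size perm_tau.
have tau0 : 0 \notin tau by rewrite (perm_mem perm_tau).
rewrite filter_map.
have -> : [seq i <- enum 'I_n | preim (fun i => nth 0 tau (index i I))
             (fun m => m != 0) i] = [seq i <- enum 'I_n | i \in I].
  apply: eq_filter => i /=; rewrite -index_mem; case: ltnP => leI.
    by apply: contraNneq tau0 => <-; rewrite mem_nth // st -sI.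
  by rewrite nth_default ?eqxx // st -sI.
rewrite -[X in perm_eq _ X](map_nth_index uI) ?st // perm_map //.
apply: uniq_perm => //.
  by rewrite filter_uniq ?enum_uniq.
by move=> i; rewrite mem_filter mem_enum andbT.
Qed.

Lemma edge_classes (K : {set 'I_n * 'I_q}) :
  K \in H -> #|[set v.1 | v in K]| = size sigma.
Proof.
rewrite inE => /andP[_ /perm_size <-].
rewrite size_filter count_map -size_filter cardE.
apply/perm_size/uniq_perm => [||i]; first exact: enum_uniq.
  exact: filter_uniq (enum_uniq _).
rewrite mem_enum mem_filter mem_enum andbT /= cards_eq0.
apply/imsetP/set0Pn => [[v vK ->]|[v]]; first by exists v; rewrite !inE vK /=.
by rewrite !inE => /andP[vK /eqP <-]; exists v.
Qed.

Lemma edge_part (K : {set 'I_n * 'I_q}) m :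
  K \in H -> m \in sigma -> exists i, #|K :&: V i| = m.
Proof.
rewrite inE => /andP[_ /perm_mem <-].
by rewrite mem_filter => /andP[_ /mapP[i _ ->]]; exists i.
Qed.

Lemma sub_preimset_edge (F : finType) (d : 'I_n * 'I_q -> F) (S : {set F})
    (I : {set 'I_n}) m :
  #|I| = size sigma -> (forall x, x \in sigma -> x <= m) ->
  (forall i, i \in I -> m <= #|V i :&: d @^-1: S|) ->
  exists2 K, K \in H & d @: K \subset S.
Proof.
move=> sI le_m geI; have uI := enum_uniq I.
have sI' : size (enum I) = size sigma by rewrite -cardE.
have pP := intersection_profile_nth uI sI' (perm_refl sigma).
have [i|K KH /andP[_ KS]] := edge_between pP (sub0set (d @^-1: S)).
  rewrite set0I cards0 /= setIC; case: (boolP (i \in enum I)) => iI.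
    apply: leq_trans (geI i _); last by rewrite -mem_enum.
    by rewrite le_m // mem_nth // -sI' index_mem.
  by rewrite nth_default // -sI' leqNgt index_mem.
exists K => //; apply/subsetP=> _ /imsetP[v vK ->].
by move/subsetP/(_ v vK): KS; rewrite inE.
Qed.

(** If one [S] of size [a] served [size sigma] classes, the parts, all at most [m], would fit into
    them and give an edge coloured by [S] alone. Summing over the sets [S] gives the bound. *)
Lemma card_concentrated_classes (F : finType) (d : 'I_n * 'I_q -> F) a m :
  (forall x, x \in sigma -> x <= m) ->
  (forall K, K \in H -> a < #|d @: K|) ->
  #|[set i | [exists S : {set F}, (#|S| == a) &&
                                  (m <= #|V i :&: d @^-1: S|)]]|
    <= 'C(#|F|, a) * (size sigma).-1.
Proof.
move=> le_m many; rewrite -card_draws -sum_nat_const.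
pose P (S : {set F}) := [set i | m <= #|V i :&: d @^-1: S|].
have -> : [set i | [exists S : {set F}, (#|S| == a) &&
            (m <= #|V i :&: d @^-1: S|)]]
    = \bigcup_(S in [set S : {set F} | #|S| == a]) P S.
  apply/setP=> i; rewrite inE.
  apply/existsP/bigcupP => [[S /andP[Sa Si]]|[S]].
    by exists S; rewrite inE.
  by rewrite !inE => Sa Si; exists S; rewrite Sa.
apply: (big_ind2 (fun (A : {set 'I_n}) k => #|A| <= k)) => [|A k B l Ak Bl|S].
- by rewrite cards0.
- by rewrite (leq_trans (leq_card_setU _ _)) // leq_add.
rewrite inE => /eqP Sa; rewrite leqNgt; apply/negP=> ltP.
have [|I [_ IP sI]] := @subset_of_card _ set0 (P S) (size sigma) (sub0set _).
  by rewrite cards0 (leq_trans (leqSpred _) ltP).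
have [i iI|K KH KS] := sub_preimset_edge sI le_m (S := S) (d := d).
  by move/subsetP/(_ i iI): IP; rewrite inE.
by have := many K KH; rewrite ltnNge -Sa subset_leq_card.
Qed.

(** Each class of [I] sees at least [b] colours of [C], so its [p i] vertices can all bring new
    colours until [b] are collected. *)
Lemma greedy_colours (F : finType) (d : 'I_n * 'I_q -> F) (C : {set F})
    (p : 'I_n -> nat) b (I : seq 'I_n) :
  uniq I -> (forall i, i \in I -> b <= #|d @: V i :&: C|) ->
  exists A : {set 'I_n * 'I_q},
    [/\ forall i, i \notin I -> A :&: V i = set0,
        forall i, #|A :&: V i| <= p i &
        minn b (\sum_(i <- I) p i) <= #|d @: A :&: C|].
Proof.
elim: I => [|i I IHI] /=.
  move=> _ _; exists set0; split=> [i _|i|]; rewrite ?set0I ?cards0 //.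
  by rewrite big_nil minn0.
move=> /andP[iI uI] leb.
have [j jI|A [A0 Ap leA]] := IHI uI; first by rewrite leb // inE jI orbT.
have [X [XV Xp leX]] := add_new_colours A (p i) (leb i (mem_head _ _)).
have XVj j := setI_other_vclass (j := j) XV.
exists (A :|: X); split=> [j|j|].
- by rewrite inE negb_or setIUl => /andP[ji jI]; rewrite A0 // XVj // setU0.
- rewrite setIUl; have [->|ji] := eqVneq j i.
    by rewrite (A0 _ iI) set0U (leq_trans _ Xp) // subset_leq_card ?subsetIl.
  by rewrite XVj // setU0.
- rewrite big_cons (leq_trans _ leX) // leq_min geq_minl /=.
  apply: leq_trans (leq_add leA (leqnn (p i))); lia.
Qed.

(* Give the smallest part to [i0], where [x] is picked. The other parts have
   room for the [b] remaining colours: collect them greedily, leaving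
   [i1], which sees all of them, for the end. *)
Lemma rainbow_edge (F : finType) (d : 'I_n * 'I_q -> F) (x : F)
    (i0 i1 : 'I_n) (I : seq 'I_n) b m :
  #|F| = b.+1 ->
  uniq [:: i0, i1 & I] -> size [:: i0, i1 & I] = size sigma ->
  x \in d @: V i0 -> [set~ x] \subset d @: V i1 ->
  (forall i, i \in I -> b <= #|d @: V i|) ->
  m \in sigma -> m + b <= r -> (forall y, y \in sigma -> y <= q) ->
  exists2 K, K \in H & d @: K = setT.
Proof.
set J := [:: i0, i1 & I] => cardF uJ sJ x0 x1 richI m_sigma le_r le_q.
(* Putting [m] first assigns it to [i0], the head of [J]. *)
pose tau := m :: rem m sigma.
have tau_sigma : perm_eq tau sigma by rewrite perm_sym perm_to_rem.
have st := perm_size tau_sigma.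
pose p i := nth 0 tau (index i J).
have pP : intersection_profile p by apply: intersection_profile_nth.
have p_gt0 i : i \in J -> 0 < p i.
  move=> iJ; rewrite lt0n; apply: contraNneq sigma_neq0 => <-.
  by rewrite -(perm_mem tau_sigma) mem_nth // st -sJ index_mem.
have p_le i : p i <= q.
  have [iJ|iJ] := boolP (i \in J).
    by rewrite le_q // -(perm_mem tau_sigma) mem_nth // st -sJ index_mem.
  by rewrite /p nth_default // st -sJ leqNgt index_mem.
have p0 : p i0 = m by rewrite /p /= eqxx.
have pJ : [seq p i | i <- J] = tau by apply: map_nth_index; rewrite ?st.
clearbody p.
have sum_p : m + (p i1 + \sum_(i <- I) p i) = r.
  rewrite -sum_sigma -(perm_sumn tau_sigma) -pJ /= p0.
  by rewrite sumnE big_map.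
have Cx : #|[set~ x]| = b by rewrite cardsC1 cardF.
move: (uJ) => /= /and3P[]; rewrite inE negb_or => /andP[i01 i0I] i1I uI.
(* One of the [b] colours may be [x] itself, so only [b.-1] are guaranteed among the others; [i1]
   supplies the last one. *)
have richI' i : i \in I -> b.-1 <= #|d @: V i :&: [set~ x]|.
  move=> /richI leb; rewrite -subn1 leq_subLR addnC (leq_trans leb) //.
  rewrite -(cardsID [set~ x] (d @: V i)) leq_add2l -(cards1 x).
  by rewrite subset_leq_card // setDE setCK subsetIr.
have [A [A0 Ap leA]] := greedy_colours p uI richI'.
have := @add_new_colours _ _ d A (V i1) [set~ x] b (p i1).
rewrite (setIidPr x1) Cx => /(_ (leqnn _))[X [XV Xp leX]].
have [v v0 xv] := imsetP x0.
pose B := v |: (A :|: X).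
have XVj j := setI_other_vclass (j := j) XV.
have vV j : j != i0 -> [set v] :&: V j = set0.
  by apply: setI_other_vclass; rewrite sub1set.
have leB i : #|B :&: V i| <= p i <= #|[set: 'I_n * 'I_q] :&: V i|.
  rewrite setTI card_vclass p_le andbT !setIUl.
  have [->|ni0] := eqVneq i i0.
    rewrite A0 ?inE // XVj // !setU0.
    rewrite (leq_trans (subset_leq_card (subsetIl _ _))) //.
    by rewrite cards1 p_gt0 // inE eqxx.
  rewrite vV // set0U; have [->|ni1] := eqVneq i i1.
    by rewrite A0 // set0U (leq_trans (subset_leq_card (subsetIl _ _))).
  by rewrite XVj // setU0.
have [K KH /andP[BK _]] := edge_between pP (subsetT B) leB.
exists K => //; apply/eqP; rewrite eqEsubset subsetT /=.
apply: subset_trans (imsetS d BK).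
have AXx : [set~ x] \subset d @: (A :|: X).
  (* All [b] colours are reached: [I] gives the minimum of [b.-1] and its total size, [i1] adds
     [p i1 > 0], and the parts other than [m] sum to [r - m >= b]. *)
  apply/setIidPr/eqP; rewrite eqEcard subsetIr Cx.
  have := p_gt0 i1; rewrite !inE eqxx orbT => /(_ isT) p1_gt0.
  apply: leq_trans leX; rewrite leq_min leqnn /=.
  apply: leq_trans (leq_add leA (leqnn (p i1))).
  by clear - p1_gt0 sum_p le_r; lia.
rewrite /B imsetU1 -xv -(setUCr [set x]).
by apply: setUSS.
Qed.

End Edges.

(** * Renaming of colours, extreme parts, and a binomial bound *)

(** Each colour is replaced by its position in the list of used colours. Since [d] need not be onto,
    one palette serves both claims (1) and (3). *)
Lemma num_colours_ord (T : finType) (c : T -> nat) (k : nat) :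
  num_colours c setT <= k.+1 ->
  exists d : T -> 'I_k.+1, forall A, num_colours c A = #|d @: A|.
Proof.
rewrite /num_colours; set L := undup _ => leL.
have cL x : c x \in L by rewrite mem_undup; apply/imageP; exists x.
exists (fun x => inord (index (c x) L)) => A; apply: num_colours_imset => x y.
have ltL z : index (c z) L < k.+1 by rewrite (leq_trans _ leL) // index_mem.
apply/eqP/eqP => [->//|/(congr1 val)].
by rewrite /= !inordK // => /(congr1 (nth 0 L)); rewrite !nth_index.
Qed.

Lemma num_colours_modn (T : finType) (w : T -> nat) (k : nat) :
  0 < k -> (forall j, j < k -> exists x, w x = j) ->
  num_colours (fun x => w x %% k) setT = k.
Proof.
move=> k_gt0 onto; rewrite /num_colours -[RHS](size_iota 0).
apply/perm_size/uniq_perm; rewrite ?undup_uniq ?iota_uniq // => j.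
rewrite mem_undup mem_iota /= add0n.
apply/imageP/idP => [[x _ ->]|ltj]; first by rewrite ltn_mod.
by have [x wx] := onto j ltj; exists x; rewrite ?inE // wx modn_small.
Qed.

Lemma num_colours_sub (T : finType) (c : T -> nat) (A B : {set T}) :
  A \subset B -> num_colours c A <= num_colours c B.
Proof.
move=> AB; rewrite uniq_leq_size ?undup_uniq // => j; rewrite !mem_undup.
move=> /imageP[x xA ->]; apply/imageP; exists x => //.
exact: (subsetP AB).
Qed.

Lemma num_colours_comp (T U : finType) (h : T -> U) (c : U -> nat)
    (A : {set T}) :
  num_colours (c \o h) A = num_colours c (h @: A).
Proof.
apply/perm_size/uniq_perm; rewrite ?undup_uniq // => j; rewrite !mem_undup.
apply/imageP/imageP => [[x xA ->]|[_ /imsetP[x xA ->] ->]].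
  by exists (h x); rewrite ?imset_f.
by exists x.
Qed.

Lemma num_colours_le_card (T : finType) (c : T -> nat) (A : {set T}) :
  num_colours c A <= #|A|.
Proof. by rewrite (leq_trans (size_undup _)) // size_image. Qed.

Lemma largest_part_mem (sigma : seq nat) :
  sigma != [::] -> largest_part sigma \in sigma.
Proof.
rewrite /largest_part; case: sigma => // x sigma _.
elim: sigma x => [|y sigma IHs] x; first by rewrite big_seq1 mem_head.
rewrite big_cons inE; have := IHs y; set m := \max_(p <- y :: sigma) p.
by case: (leqP x m) => _ mem_m; rewrite ?mem_m ?eqxx ?orbT.
Qed.

Lemma smallest_part_mem (sigma : seq nat) :
  sigma != [::] -> smallest_part sigma \in sigma.
Proof.
move=> /largest_part_mem; rewrite /smallest_part; set m := largest_part _.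
move=> m_in.
(* The iterated minimum may return its neutral element [m], which is itself a part. *)
suff : \big[minn/m]_(p <- sigma) p \in m :: sigma.
  by rewrite inE => /predU1P[->|].
elim: (sigma) => [|x tau IHt]; first by rewrite big_nil mem_head.
rewrite big_cons !inE; set m' := \big[minn/m]_(p <- tau) p in IHt *.
case: (leqP x m') => _; first by rewrite eqxx orbT.
by move: IHt; rewrite inE => /orP[->|->]; rewrite ?orbT.
Qed.

Lemma leq_bin (m k : nat) : 0 < k < m -> m <= 'C(m, k).
Proof.
case: k => // k; elim: m => // m IHm /=; rewrite ltnS leq_eqVlt binS.
case/predU1P=> [<-|ltkm]; first by rewrite binn binSn add1n.
have := IHm ltkm; have : 0 < 'C(m, k) by rewrite bin_gt0; lia.
lia.
Qed.

(** * Excluded numbers of colours, explicit colourings, and the gap *)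

Theorem theorem5p1 (sigma : seq nat) (r n q alpha beta s Delta delta : nat)
    (r_gt0 : 0 < r) (sigma_part : is_partition sigma r)
    (n_gt0 : 0 < n) (q_gt0 : 0 < q)
    (s_def : s = size sigma)
    (Delta_def : Delta = largest_part sigma)
    (delta_def : delta = smallest_part sigma)
    (alpha_ge2 : 2 <= alpha)
    (alpha_le_Delta : alpha <= Delta)
    (delta_le : delta + beta <= r)
    (alpha_s_beta : alpha <= s <= beta)
    (q_def : q = (beta - alpha + 1) * ((Delta - 1) %/ (alpha - 1)) + (Delta - 1))
    (n_ge : 'C(beta + 1, alpha - 1) * (s - 1) + s <= n) :
  let H := sigma_hypergraph n r q sigma in
  let f := (s - 1) %/ (alpha - 1) in
  [/\ forall k : nat, k <= beta - 1 -> ~ has_k_colouring H alpha beta k,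
      has_k_colouring H alpha beta beta,
      ~ has_k_colouring H alpha beta (beta + 1),
      forall k : nat,
        (Num.ceil ((n%:R - (s%:R - 1 - (alpha%:R - 1) * f%:R)) / f%:R : rat)
           <= k%:Z)%R ->
        k <= n ->
        has_k_colouring H alpha beta k
    & has_gap (spectrum H alpha beta)].
Proof.
have [/andP[alpha_s s_beta] a_gt0] : (alpha <= s <= beta) /\ 0 < alpha - 1.
  by split=> //; lia.
case/and3P: sigma_part => _ sigma_neq0 /eqP sum_sigma.
have sigma_nil : sigma != [::] by rewrite -size_eq0 -s_def; lia.
have Delta_in : Delta \in sigma by rewrite Delta_def largest_part_mem.
have delta_in : delta \in sigma by rewrite delta_def smallest_part_mem.
have le_Delta x : x \in sigma -> x <= Delta.
  by move=> x_in; rewrite Delta_def; apply: leq_bigmax_seq.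
move: q_def n_ge; set a := alpha - 1; set g := (Delta - 1) %/ a => q_def n_ge.
have alphaE : alpha = a + 1 by rewrite subnK // ltnW.
have g_gt0 : 0 < g by rewrite divn_gt0 // leq_sub2r.
have betaE : beta = beta - alpha + 1 + a by lia.
have b_gt0 : 0 < beta - alpha + 1 by rewrite addn1.
pose e := (Delta - 1) %% a.
have Delta_eq : Delta = a * g + e + 1.
  by rewrite mulnC -divn_eq subnK // (leq_trans _ alpha_le_Delta) // ltnW.
have Delta_lt : e < a by rewrite ltn_mod.
(* With [Delta - 1 = a * g + e], the [a * g] completes [(beta - alpha + 1) * g] to [beta * g]. *)
have q_eq : q = beta * g + e.
  by rewrite betaE mulnDl; lia.
have Delta_q : Delta <= q.
  have : 0 < (beta - alpha + 1) * g by rewrite muln_gt0 b_gt0.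
  lia.
set f := (s - 1) %/ a => H; pose t := (s - 1) %% a.
have f_gt0 : 0 < f by rewrite divn_gt0 // leq_sub2r.
have s_eq : s = a * f + t + 1.
  by rewrite mulnC -divn_eq subnK // (leq_trans _ alpha_s) // ltnW.
have t_lt : t < s by rewrite s_eq addn1 ltnS leq_addl.
have s_ge2 : 2 <= s := leq_trans alpha_ge2 alpha_s.
have beta_gt0 : 0 < beta := leq_trans (ltnW s_ge2) s_beta.
have s_n : s <= n := leq_trans (leq_addl _ _) n_ge.
clearbody a f g e t.
(* The binomial coefficient in the bound on [n] counts the [a]-sets of the palette; the final [+ s]
   leaves [s] classes that are not concentrated. *)
have many_rich (d : 'I_n * 'I_q -> 'I_beta.+1) :
    (forall K, K \in H -> alpha <= #|d @: K|) ->
    exists2 R : {set 'I_n}, s <= #|R| &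
      forall i, i \in R -> beta <= #|d @: vclass q i|.
  move=> many.
  pose P := [set i | [exists S : {set 'I_beta.+1}, (#|S| == a) &&
                       (Delta <= #|vclass q i :&: d @^-1: S|)]].
  have leP : #|P| <= 'C(beta + 1, a) * (s - 1).
    have := card_concentrated_classes sigma_neq0 sum_sigma
      (d := d) (a := a) le_Delta.
    rewrite card_ord -s_def addn1 subn1; apply=> K /many.
    by rewrite alphaE addn1.
  exists (~: P) => [|i].
    rewrite -(leq_add2l #|P|) cardsC card_ord (leq_trans _ n_ge) //.
    by rewrite leq_add2r.
  rewrite !inE negb_exists => /forallP small.
  rewrite [leqLHS]betaE.
  (* Here [b] is [beta - alpha + 1], and the given [q] is exactly the required
     [b * g + Delta.-1]. *)
  apply: (num_colours_of_small_unions (g := g) (m := Delta)) => //.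
  - lia.
  - by rewrite card_ord; lia.
  - by rewrite mulnS; lia.
  - by rewrite card_vclass; lia.
  - by move=> S Sa; have := small S; rewrite Sa eqxx ltnNge.
have few k : k <= beta - 1 -> ~ has_k_colouring H alpha beta k.
  move=> lek [c [cP ck]].
  have [|d dc] := @num_colours_ord _ c beta; first by rewrite ck; lia.
  have [K KH|R sR richR] := many_rich d.
    by rewrite -dc; have /andP[] := cP K KH.
  have [i iR] : exists i, i \in R by apply/card_gt0P; lia.
  have := richR i iR; rewrite leqNgt => /negP; apply.
  apply: leq_ltn_trans (subset_leq_card (imsetS d (subsetT _))) _.
  by rewrite -(dc setT) ck; lia.
have beta_col : has_k_colouring H alpha beta beta.
  pose w (v : 'I_n * 'I_q) : nat := v.2.
  exists (fun v => w v %% beta); split.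
    move=> K KH; apply/andP; split; last first.
      rewrite -[leqRHS](size_iota 0) uniq_leq_size ?undup_uniq // => j.
      rewrite mem_undup => /imageP[v _ ->].
      by rewrite mem_iota /= add0n ltn_mod; lia.
    (* The part [Delta = a * g + e + 1] inside one class already forces more than [a] residues,
       since [q = beta * g + e]. *)
    have [i Ki] := edge_part KH Delta_in.
    apply: leq_trans (num_colours_sub _ (subsetIl K (vclass q i))).
    rewrite (num_colours_comp snd (fun j : 'I_q => j %% beta)).
    have := @card_le_num_residues q beta g (e)
      [set v.2 | v in K :&: vclass q i].
    rewrite card_in_imset ?Ki; last first.
      move=> [i1 j1] [i2 j2]; rewrite !inE /=.
      by move=> /andP[_ /eqP->] /andP[_ /eqP->] ->.
    rewrite {1}q_eq => /(_ (leqnn _)); set N := num_colours _ _ => leN.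
    rewrite leqNgt; apply/negP => ltN.
    have : N * g <= a * g by rewrite leq_mul2r; lia.
    lia.
  apply: num_colours_modn => [|j ltj]; first lia.
  have ltjq : j < q.
    rewrite q_eq (leq_trans ltj) // (leq_trans _ (leq_addr _ _)) //.
    by rewrite leq_pmulr.
  by exists (Ordinal n_gt0, Ordinal ltjq).
have no_beta1 : ~ has_k_colouring H alpha beta (beta + 1).
  move=> [c [cP ck]].
  have [|d dc] := @num_colours_ord _ c beta; first by rewrite ck addn1.
  have dT : d @: setT = setT.
    by apply/eqP; rewrite eqEcard subsetT cardsT card_ord -dc ck addn1 /=.
  have onto x : exists i, x \in d @: vclass q i.
    have : x \in d @: setT by rewrite dT inE.
    by case/imsetP=> v _ ->; exists v.1; rewrite imset_f // inE.
  have [K KH|R sR richR] := many_rich d.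
    by rewrite -dc; have /andP[] := cP K KH.
  (* A rich class misses at most one colour. If it misses [x], then [x] occurs in some other class
     [i0]; if it misses none, any colour of a second rich class serves as [x]. *)
  have [x [i0 [i1 [i01 i1R x0 x1]]]] : exists x i0 i1,
      [/\ i0 != i1, i1 \in R, x \in d @: vclass q i0
        & [set~ x] \subset d @: vclass q i1].
    have /card_gt1P[i [j [iR jR ij]]] : 1 < #|R| by lia.
    have missing i' x : i' \in R -> x \notin d @: vclass q i' ->
        [set~ x] \subset d @: vclass q i'.
      move=> i'R xi'; suff <- : d @: vclass q i' = [set~ x] by [].
      apply/eqP; rewrite eqEcard cardsC1 card_ord richR // andbT.
      by apply/subsetP=> y yi'; rewrite !inE; apply: contraNneq xi' => <-.
    have [full|/subsetPn[x _ xi]] := boolP (setT \subset d @: vclass q i).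
      have /card_gt0P[x xj] : 0 < #|d @: vclass q j|.
        by apply: leq_trans beta_gt0 (richR j jR).
      by exists x, j, i; rewrite eq_sym ij (subset_trans (subsetT _) full).
    have [i' xi'] := onto x; exists x, i', i; split=> //.
      by apply: contraNneq xi => <-.
    exact: missing.
  have [|I [_ IR sI]] :=
      @subset_of_card _ set0 (R :\ i0 :\ i1) (s - 2) (sub0set _).
    (* The class [i0] need not be rich, so at most two elements are removed from [R]. *)
    rewrite cards0 /= leq_subLR; apply: leq_trans sR _.
    rewrite (cardsD1 i0 R) (cardsD1 i1 (R :\ i0)) addnA leq_add2r.
    exact: leq_add (leq_b1 _) (leq_b1 _).
  have inR i : i \in I -> [/\ i != i0, i != i1 & i \in R].
    by move/(subsetP IR); rewrite !inE => /and3P[].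
  have [||i||y /le_Delta|K KH dK] := @rainbow_edge n q r sigma sigma_neq0
    sum_sigma _ d x i0 i1 (enum I) beta delta (card_ord _) _ _ x0 x1 _ delta_in.
  - rewrite /= inE negb_or i01 enum_uniq !mem_enum /= andbT.
    by apply/andP; split; apply/negP => /inR[]; rewrite eqxx.
  - by rewrite /= -cardE sI -s_def; rewrite -[RHS](subnK s_ge2) addn2.
  - by rewrite mem_enum => /inR[_ _ /richR].
  - by [].
  - by move/leq_trans; apply.
  have /andP[_] := cP K KH.
  by rewrite dc dK cardsT card_ord ltnn.
(* The hypothesis is the ceiling bound with denominators cleared, as [s - 1 - a * f = t]. *)
have k_col k : n <= k * f + t -> k <= n ->
    has_k_colouring H alpha beta k.
  move=> len lek.
  have k_gt0 : 0 < k.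
    rewrite lt0n; apply: contraTneq len => ->.
    by rewrite -ltnNge (leq_trans t_lt).
  pose w (v : 'I_n * 'I_q) : nat := v.1.
  exists (fun v => w v %% k); split; last first.
    apply: num_colours_modn => // j ltj.
    by exists (Ordinal (leq_trans ltj lek), Ordinal q_gt0).
  move=> K KH; rewrite (num_colours_comp fst (fun i : 'I_n => i %% k)).
  (* Classes are monochromatic and an edge meets [s] of them: hence at most [s <= beta] colours, and
     more than [a] because [s = a * f + t + 1]. *)
  have sK := edge_classes KH; apply/andP; split; last first.
    by rewrite (leq_trans (num_colours_le_card _ _)) // sK -s_def.
  have := card_le_num_residues [set v.1 | v in K] len.
  rewrite sK -s_def; set N := num_colours _ _ => leN.
  rewrite leqNgt; apply/negP => ltN.
  have : N * f <= a * f by rewrite leq_mul2r; lia.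
  lia.
split=> // [k|].
  rewrite ceil_le_int ler_pdivrMr ?ltr0n // => lek; apply: k_col.
  rewrite -(ler_nat rat) natrD natrM.
  have sE : (s%:R = a%:R * f%:R + t%:R + 1 :> rat)%R.
    by rewrite {1}s_eq !natrD natrM.
  by move: lek; rewrite alphaE natrD sE -pmulrn; lra.
(* That [n] exceeds [beta + 1] follows from [s >= 2] and the binomial coefficient being at least
   [beta + 1]. *)
exists beta, (beta + 1), n; split=> //; first by rewrite addn1.
  have : beta + 1 <= 'C(beta + 1, a) by rewrite leq_bin; lia.
  nia.
apply: k_col => //; nia.
Qed.
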